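(* Let $\mathcal{C}$ be a triangulated category and let $P,P'$ be subclasses of $\mathrm{Obj}\,\mathcal{C}$. Let $s=(\mathcal{LO},\mathcal{RO})$ and $s'=(\mathcal{LO}',\mathcal{RO}')$ be torsion pairs for $\mathcal{C}$; assume that a class $P_s\subset\mathrm{Obj}\,\mathcal{C}$ generates $s$ (i.e., $\mathcal{RO}=P_s^{\perp}$) and a class $P_{s'}\subset\mathrm{Obj}\,\mathcal{C}$ cogenerates $s'$ (i.e., $\mathcal{LO}'={}^{\perp}P_{s'}$, and so $P_{s'}\subset\mathcal{RO}'$). Then the following statements are valid. 1. $P_s$ is weakly symmetric to $P'$ if and only if $\mathcal{LO}$ is weakly symmetric to $P'$. 2. $P$ is weakly symmetric to $P_{s'}$ if and only if $P$ is weakly symmetric to $\mathcal{RO}'$. 3. The following conditions are equivalent: (i) $P_s$ is weakly symmetric to $P_{s'}$; (ii) $\mathcal{LO}$ is symmetric to $\mathcal{RO}'$; (iii) there exist a class $Q$ that generates $s$ and a class $Q'$ that cogenerates $s'$ such that $Q$ is symmetric to $Q'$; (iv) $s$ is left adjacent to $s'$ (i.e., $\mathcal{RO}=\mathcal{LO}'$). 4. Assume that $\mathcal{C}$ has small coproducts and satisfies the Brown representability property, $P_s$ is a class of compact objects, and $s'$ is right adjacent to $s$ (i.e., $\mathcal{RO}=\mathcal{LO}'$). Then $s$ is smashing, $s'$ is cosmashing, and $s'$ is cogenerated by the Brown-Comenetz duals of elements of $P_s$ (i.e., $\mathcal{LO}'={}^{\perp}\{\hat{p}:\ p\in P_s\}$).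 5. For $\mathcal{C}$ as in part 4 (having small coproducts and satisfying Brown representability) assume that $P$ is a class of compact objects and it generates a weight structure $w$ on $\mathcal{C}$ (i.e., $\mathcal{C}_{w\ge 1}=P^{\perp}$). Then $w$ is smashing, there exists a cosmashing $t$-structure $t$ right adjacent to $w$, and $t$ is cogenerated by the Brown-Comenetz duals of elements of $P$ (i.e., $\mathcal{C}^{t\le -1}={}^{\perp}\{\hat{p}:\ p\in P\}$).
   Context: For a class $S$ of objects: $S^{\perp}=\{Y: \mathcal{C}(X,Y)=0\ \forall X\in S\}$, ${}^{\perp}S=\{Y:\mathcal{C}(Y,X)=0\ \forall X\in S\}$. A torsion pair for $\mathcal{C}$ is a couple $(\mathcal{LO},\mathcal{RO})$ of classes of objects with $\mathcal{LO}^{\perp}=\mathcal{RO}$, $\mathcal{LO}={}^{\perp}\mathcal{RO}$, and such that every object $M$ fits in a distinguished triangle $L\to M\to R\to L[1]$ with $L\in\mathcal{LO}$, $R\in\mathcal{RO}$. It is smashing if $\mathcal{C}$ has coproducts and $\mathcal{RO}$ is closed under small coproducts; cosmashing if $\mathcal{C}$ has products and $\mathcal{LO}$ is closed under small products. $P$ is weakly symmetric to $P'$ if $P^{\perp}={}^{\perp}P'$. A morphism $h$ is $P$-null if $\mathcal{C}(M,h)=0$ for all $M\in P$ and $P'$-conull if $\mathcal{C}(h,M)=0$ for all $M\in P'$; $P$ is symmetric to $P'$ if the class of $P$-null morphisms equals the class of $P'$-conull morphisms. Brown representability property: $\mathcal{C}$ has coproducts and every cohomological functor $\mathcal{C}^{op}\to\mathrm{Ab}$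 converting coproducts into products is representable. For $p$ compact, its Brown-Comenetz dual $\hat{p}$ is the object representing $M\mapsto\mathrm{Ab}(\mathcal{C}(p,M),\mathbb{Q}/\mathbb{Z})$ (it exists under Brown representability). $p$ is compact if $\mathcal{C}(p,-)$ respects small coproducts. Weight structures: a pair $(\mathcal{C}_{w\le 0},\mathcal{C}_{w\ge 0})$ of classes of objects such that: (i) both are closed under retracts in $\mathcal{C}$; (ii) $\mathcal{C}_{w\le 0}\subset \mathcal{C}_{w\le 0}[1]$ and $\mathcal{C}_{w\ge 0}[1]\subset \mathcal{C}_{w\ge 0}$; (iii) $\mathcal{C}(X,Y)=0$ for $X\in\mathcal{C}_{w\le 0}$, $Y\in \mathcal{C}_{w\ge 0}[1]$; (iv) every object $M$ fits in a distinguished triangle $LM\to M\to RM\to LM[1]$ with $LM\in\mathcal{C}_{w\le 0}$, $RM\in \mathcal{C}_{w\ge 0}[1]$. $\mathcal{C}_{w\ge i}=\mathcal{C}_{w\ge 0}[i]$. $w$ is smashing if $\mathcal{C}$ has coproducts and $\mathcal{C}_{w\ge 0}$ is closed under small coproducts. A $t$-structure $t$ (cohomological convention, $\mathcal{C}^{t\le n}=\mathcal{C}^{t\le 0}[-n]$) is right adjacent to $w$ if $\mathcal{C}^{t\le 0}=\mathcal{C}_{w\ge 0}$; $t$ is cosmashing if $\mathcal{C}$ has products and $\mathcal{C}^{t\le 0}$ is closed under small products. *)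

(* Defs.v *)
From HB Require Import structures.
From mathcomp Require Import all_boot all_order all_algebra.
From mathcomp Require Import ring_quotient boolp classical_sets.

Set Implicit Arguments.
Unset Strict Implicit.
Unset Printing Implicit Defensive.

Import GRing.Theory.
Local Open Scope classical_set_scope.
Local Open Scope ring_scope.

(* Every family of objects below is indexed by this one constant, so that all
   the small (co)products range over the same universe; with [Type] written at
   each occurrence the universes would be unrelated. *)
Definition small := Type.

Section AdditiveMaps.
Variables A B : zmodType.
Implicit Types f g h : {additive A -> B}.

Lemma additive_ext f g : f =1 g -> f = g.
Proof.
case: f => f [[cf]]; case: g => g [[cg]] /= /funext efg.
by rewrite efg in cf *; rewrite (Prop_irrelevance cf cg).
Qed.

HB.instance Definition _ := gen_eqMixin {additive A -> B}.
HB.instance Definition _ := gen_choiceMixin {additive A -> B}.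

Definition addmap0 : {additive A -> B} := \0.
Definition addmapN f : {additive A -> B} := \- f.
Definition addmapD f g : {additive A -> B} := f \+ g.

Lemma addmapDA : associative addmapD.
Proof. by move=> f g h; apply: additive_ext => x /=; rewrite addrA. Qed.

Lemma addmapDC : commutative addmapD.
Proof. by move=> f g; apply: additive_ext => x /=; rewrite addrC. Qed.

Lemma addmap0D : left_id addmap0 addmapD.
Proof. by move=> f; apply: additive_ext => x /=; rewrite add0r. Qed.

Lemma addmapND : left_inverse addmap0 addmapN addmapD.
Proof. by move=> f; apply: additive_ext => x /=; rewrite addNr. Qed.

HB.instance Definition _ :=
  GRing.isZmodule.Build {additive A -> B} addmapDA addmapDC addmap0D addmapND.

End AdditiveMaps.

Definition ab_coproduct (I : small) (A : I -> zmodType) (S : zmodType)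
    (inj : forall i, {additive A i -> S}) : Prop :=
  forall (B : zmodType) (f : forall i, {additive A i -> B}),
    exists! g : {additive S -> B}, forall i x, g (inj i x) = f i x.

Definition rat_int : {pred rat} := fun x => x \is a Num.int.

Lemma rat_int_zmod_closed : zmod_closed rat_int.
Proof.
by split=> [|x y]; rewrite !unfold_in; [exact: rpred0 | exact: rpredB].
Qed.

HB.instance Definition _ :=
  GRing.isZmodClosed.Build rat rat_int rat_int_zmod_closed.

Definition QmodZ : zmodType := Quotient.quot rat_int.

Record preadditive := Preadditive {
  obj :> Type;
  mor : obj -> obj -> zmodType;
  idm : forall X, mor X X;
  mcomp : forall X Y Z, mor Y Z -> mor X Y -> mor X Z;
  mcompA : forall X Y Z T (h : mor Z T) (g : mor Y Z) (f : mor X Y),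
    mcomp h (mcomp g f) = mcomp (mcomp h g) f;
  mcomp1m : forall X Y (f : mor X Y), mcomp (idm Y) f = f;
  mcompm1 : forall X Y (f : mor X Y), mcomp f (idm X) = f;
  mcompDl : forall X Y Z (g h : mor Y Z) (f : mor X Y),
    mcomp (g + h) f = mcomp g f + mcomp h f;
  mcompDr : forall X Y Z (h : mor Y Z) (f g : mor X Y),
    mcomp h (f + g) = mcomp h f + mcomp h g
}.
Arguments mor {_} _ _.
Arguments idm {_} _.
Arguments mcomp {_ _ _ _} _ _.

Notation "g \c f" := (mcomp g f) (at level 40, left associativity).

Section Preadditive.
Variable C : preadditive.
Implicit Types X Y Z : C.

Definition is_iso X Y (f : mor X Y) : Prop :=
  exists g : mor Y X, g \c f = idm X /\ f \c g = idm Y.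

Definition isomorphic X Y : Prop := exists f : mor X Y, is_iso f.

Definition retract X Y : Prop :=
  exists (i : mor X Y) (r : mor Y X), r \c i = idm X.

Definition is_zero Z : Prop :=
  (forall X (f : mor X Z), f = 0) /\ (forall X (f : mor Z X), f = 0).

Definition is_biproduct X Y Z : Prop :=
  exists (i1 : mor X Z) (i2 : mor Y Z) (p1 : mor Z X) (p2 : mor Z Y),
    [/\ p1 \c i1 = idm X, p2 \c i2 = idm Y, p1 \c i2 = 0, p2 \c i1 = 0
      & i1 \c p1 + i2 \c p2 = idm Z].

Definition is_additive : Prop :=
  (exists Z, is_zero Z) /\ (forall X Y, exists Z, is_biproduct X Y Z).

Definition coproduct (I : small) (X : I -> C) (S : C)
    (inj : forall i, mor (X i) S) : Prop :=
  forall Y (f : forall i, mor (X i) Y),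
    exists! g : mor S Y, forall i, g \c inj i = f i.

Definition product (I : small) (X : I -> C) (S : C)
    (proj : forall i, mor S (X i)) : Prop :=
  forall Y (f : forall i, mor Y (X i)),
    exists! g : mor Y S, forall i, proj i \c g = f i.

Definition has_coproducts : Prop :=
  forall (I : small) (X : I -> C),
    exists (S : C) (inj : forall i, mor (X i) S), coproduct inj.

Definition has_products : Prop :=
  forall (I : small) (X : I -> C),
    exists (S : C) (proj : forall i, mor S (X i)), product proj.

Definition closed_under_coproducts (K : set C) : Prop :=
  forall (I : small) (X : I -> C) (S : C) (inj : forall i, mor (X i) S),
    coproduct inj -> (forall i, K (X i)) -> K S.

Definition closed_under_products (K : set C) : Prop :=
  forall (I : small) (X : I -> C) (S : C) (proj : forall i, mor S (X i)),
    product proj -> (forall i, K (X i)) -> K S.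

Definition closed_under_isos (K : set C) : Prop :=
  forall X Y, isomorphic X Y -> K Y -> K X.

Definition closed_under_retracts (K : set C) : Prop :=
  forall X Y, retract X Y -> K Y -> K X.

(* $S^\perp$ and ${}^\perp S$ *)
Definition rperp (S : set C) : set C :=
  [set Y | forall X, S X -> forall f : mor X Y, f = 0].

Definition lperp (S : set C) : set C :=
  [set Y | forall X, S X -> forall f : mor Y X, f = 0].

Definition weakly_symmetric (P P' : set C) : Prop := rperp P = lperp P'.

Definition null (P : set C) X Y (h : mor X Y) : Prop :=
  forall M, P M -> forall f : mor M X, h \c f = 0.

Definition conull (P' : set C) X Y (h : mor X Y) : Prop :=
  forall M, P' M -> forall f : mor Y M, f \c h = 0.

Definition symmetric_to (P P' : set C) : Prop :=
  forall X Y (h : mor X Y), null P h <-> conull P' h.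

Section Post.
Variables (M X Y : C) (f : mor X Y).

Lemma mcomp_zmod_morphism : zmod_morphism (@mcomp C M X Y f).
Proof.
by move=> g h; apply/eqP; rewrite eq_sym subr_eq -mcompDr subrK.
Qed.

HB.instance Definition _ :=
  GRing.isZmodMorphism.Build (mor M X) (mor M Y) (@mcomp C M X Y f)
    mcomp_zmod_morphism.

Definition post : {additive mor M X -> mor M Y} := @mcomp C M X Y f.

End Post.

Definition compact (p : C) : Prop :=
  forall (I : small) (X : I -> C) (S : C) (inj : forall i, mor (X i) S),
    coproduct inj -> ab_coproduct (fun i => post p (inj i)).

(* Additive functors from the opposite of C to abelian groups. *)
Record cofunctor := Cofunctor {
  coobj :> C -> zmodType;
  comap : forall X Y, mor X Y -> {additive coobj Y -> coobj X};
  comap1 : forall X x, comap (idm X) x = x;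
  comapM : forall X Y Z (g : mor Y Z) (f : mor X Y) z,
    comap (g \c f) z = comap f (comap g z);
  comapD : forall X Y (f g : mor X Y) y,
    comap (f + g) y = comap f y + comap g y
}.

Definition coproducts_to_products (H : cofunctor) : Prop :=
  forall (I : small) (X : I -> C) (S : C) (inj : forall i, mor (X i) S),
    coproduct inj ->
    forall x : (forall i, H (X i)),
      exists! y : H S, forall i, comap H (inj i) y = x i.

Definition represents (H : cofunctor) (A : C) : Prop :=
  exists phi : forall M, {additive mor M A -> H M},
    (forall M, bijective (phi M)) /\
    (forall M N (f : mor M N) (g : mor N A),
       phi M (g \c f) = comap H f (phi N g)).

Definition representable (H : cofunctor) : Prop := exists A, represents H A.

Section BrownComenetz.
Variable p : C.

Section Pre.
Variables (X Y : C) (f : mor X Y).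

Definition bc_pre (u : {additive mor p Y -> QmodZ}) :
    {additive mor p X -> QmodZ} := u \o post p f.

Lemma bc_pre_zmod_morphism : zmod_morphism bc_pre.
Proof. by move=> u v; apply: additive_ext. Qed.

HB.instance Definition _ :=
  GRing.isZmodMorphism.Build {additive mor p Y -> QmodZ}
    {additive mor p X -> QmodZ} bc_pre bc_pre_zmod_morphism.

Definition bc_map :
  {additive {additive mor p Y -> QmodZ} -> {additive mor p X -> QmodZ}} :=
  bc_pre.
End Pre.

Lemma bc_map1 X u : bc_map (idm X) u = u.
Proof. by apply: additive_ext => x /=; rewrite mcomp1m. Qed.

Lemma bc_mapM X Y Z (g : mor Y Z) (f : mor X Y) u :
  bc_map (g \c f) u = bc_map f (bc_map g u).
Proof. by apply: additive_ext => x /=; rewrite mcompA. Qed.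

Lemma bc_mapD X Y (f g : mor X Y) u :
  bc_map (f + g) u = bc_map f u + bc_map g u.
Proof. by apply: additive_ext => x /=; rewrite mcompDl raddfD. Qed.

(* $M \mapsto \mathrm{Ab}(\mathcal{C}(p, M), \mathbb{Q}/\mathbb{Z})$ *)
Definition bc_functor : cofunctor := Cofunctor bc_map1 bc_mapM bc_mapD.

End BrownComenetz.

(* Representing objects are determined only up to isomorphism, so "the" dual
   is a predicate and [bc_duals P] contains every choice of the duals of the
   elements of P. *)
Definition bc_dual (p ph : C) : Prop := represents (bc_functor p) ph.

Definition bc_duals (P : set C) : set C :=
  [set ph | exists2 p, P p & bc_dual p ph].

Definition have_bc_duals (P : set C) : Prop :=
  forall p, P p -> exists ph, bc_dual p ph.

End Preadditive.

Record functor (C D : preadditive) := Functor {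
  fobj :> C -> D;
  fmap : forall X Y, {additive mor X Y -> mor (fobj X) (fobj Y)};
  fmap1 : forall X, fmap X X (idm X) = idm (fobj X);
  fmapM : forall X Y Z (g : mor Y Z) (f : mor X Y),
    fmap X Z (g \c f) = fmap Y Z g \c fmap X Y f
}.
Arguments fmap {C D} _ {X Y}.

Definition functor_id (C : preadditive) : functor C C.
Proof. by exists id (fun X Y => idfun). Defined.

Definition functor_comp (C D E : preadditive) (G : functor D E)
  (F : functor C D) : functor C E.
Proof.
exists (fun X => G (F X)) (fun X Y => fmap G \o fmap F) => [X|X Y Z g f] /=.
  by rewrite !fmap1.
by rewrite !fmapM.
Defined.

Definition naturally_isomorphic (C D : preadditive) (F G : functor C D) :
    Prop :=
  exists phi : forall X, mor (F X) (G X),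
    (forall X, is_iso (phi X)) /\
    (forall X Y (f : mor X Y), fmap G f \c phi X = phi Y \c fmap F f).

(* The shift is an additive auto-equivalence with a chosen quasi-inverse (it is
   not required to be a strict automorphism).  [dist f g h] says that
   X -f-> Y -g-> Z -h-> X[1] is a distinguished triangle. *)
Record triangulated := Triangulated {
  tri_cat :> preadditive;
  tri_additive : is_additive tri_cat;
  shift : functor tri_cat tri_cat;
  unshift : functor tri_cat tri_cat;
  shiftK : naturally_isomorphic (functor_comp unshift shift)
             (functor_id tri_cat);
  unshiftK : naturally_isomorphic (functor_comp shift unshift)
               (functor_id tri_cat);
  dist : forall X Y Z : tri_cat,
    mor X Y -> mor Y Z -> mor Z (shift X) -> Prop;
  tr1_iso : forall (X Y Z X' Y' Z' : tri_cat)
      (f : mor X Y) (g : mor Y Z) (h : mor Z (shift X))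
      (f' : mor X' Y') (g' : mor Y' Z') (h' : mor Z' (shift X'))
      (a : mor X X') (b : mor Y Y') (c : mor Z Z'),
    is_iso a -> is_iso b -> is_iso c ->
    b \c f = f' \c a -> c \c g = g' \c b -> fmap shift a \c h = h' \c c ->
    dist f g h -> dist f' g' h';
  tr1_id : forall X Z : tri_cat, is_zero Z ->
    dist (idm X) (0 : mor X Z) (0 : mor Z (shift X));
  tr1_cone : forall (X Y : tri_cat) (f : mor X Y),
    exists (Z : tri_cat) (g : mor Y Z) (h : mor Z (shift X)), dist f g h;
  tr2 : forall (X Y Z : tri_cat)
      (f : mor X Y) (g : mor Y Z) (h : mor Z (shift X)),
    dist f g h <-> dist g h (- fmap shift f);
  tr3 : forall (X Y Z X' Y' Z' : tri_cat)
      (f : mor X Y) (g : mor Y Z) (h : mor Z (shift X))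
      (f' : mor X' Y') (g' : mor Y' Z') (h' : mor Z' (shift X'))
      (a : mor X X') (b : mor Y Y'),
    dist f g h -> dist f' g' h' -> b \c f = f' \c a ->
    exists c : mor Z Z',
      c \c g = g' \c b /\ fmap shift a \c h = h' \c c;
  tr4 : forall (X Y Z U V W : tri_cat) (f : mor X Y) (g : mor Y Z)
      (p1 : mor Y U) (d1 : mor U (shift X))
      (p2 : mor Z W) (d2 : mor W (shift X))
      (p3 : mor Z V) (d3 : mor V (shift Y)),
    dist f p1 d1 -> dist (g \c f) p2 d2 -> dist g p3 d3 ->
    exists (a : mor U W) (b : mor W V),
      [/\ dist a b (fmap shift p1 \c d3),
          a \c p1 = p2 \c g, d2 \c a = d1,
          b \c p2 = p3 & d3 \c b = fmap shift f \c d2]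
}.
Arguments dist {_ X Y Z} _ _ _.
Arguments shift {_}.
Arguments unshift {_}.

Section Triangulated.
Variable C : triangulated.

Definition shiftn (n : int) (X : C) : C :=
  match n with
  | Posz k => iter k shift X
  | Negz k => iter k.+1 unshift X
  end.

(* K[n], closed under isomorphism: the shift is only an equivalence, so the
   bare image of K would in general fail to be a strict class. *)
Definition shift_class (K : set C) (n : int) : set C :=
  [set Y | exists2 X, K X & isomorphic Y (shiftn n X)].

Definition cohomological (H : cofunctor C) : Prop :=
  forall (X Y Z : C) (f : mor X Y) (g : mor Y Z) (h : mor Z (shift X)),
    dist f g h ->
    forall y : H Y, comap H f y = 0 <-> exists z, comap H g z = y.

Definition brown_representability : Prop :=
  has_coproducts C /\
  forall H : cofunctor C,
    cohomological H -> coproducts_to_products H -> representable H.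

Record torsion_pair := TorsionPair {
  LO : set C;
  RO : set C;
  torsion_rperp : rperp LO = RO;
  torsion_lperp : LO = lperp RO;
  torsion_decomp : forall M : C,
    exists (L R : C) (f : mor L M) (g : mor M R) (h : mor R (shift L)),
      [/\ LO L, RO R & dist f g h]
}.

Definition generates (P : set C) (s : torsion_pair) : Prop :=
  RO s = rperp P.

Definition cogenerates (P : set C) (s : torsion_pair) : Prop :=
  LO s = lperp P.

Definition left_adjacent (s s' : torsion_pair) : Prop := RO s = LO s'.

Definition smashing (s : torsion_pair) : Prop :=
  has_coproducts C /\ closed_under_coproducts (RO s).

Definition cosmashing (s : torsion_pair) : Prop :=
  has_products C /\ closed_under_products (LO s).

Record weight_structure := WeightStructure {
  wle0 : set C;
  wge0 : set C;
  wle0_retracts : closed_under_retracts wle0;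
  wge0_retracts : closed_under_retracts wge0;
  wle0_shift : wle0 `<=` shift_class wle0 1;
  wge0_shift : shift_class wge0 1 `<=` wge0;
  weight_orth : forall X Y, wle0 X -> shift_class wge0 1 Y ->
    forall f : mor X Y, f = 0;
  weight_decomp : forall M : C,
    exists (L R : C) (f : mor L M) (g : mor M R) (h : mor R (shift L)),
      [/\ wle0 L, shift_class wge0 1 R & dist f g h]
}.

Definition wge (w : weight_structure) (i : int) : set C :=
  shift_class (wge0 w) i.

Definition weight_generated_by (w : weight_structure) (P : set C) : Prop :=
  wge w 1 = rperp P.

Definition weight_smashing (w : weight_structure) : Prop :=
  has_coproducts C /\ closed_under_coproducts (wge0 w).

(* Cohomological convention: [tle0] is $\mathcal{C}^{t\le 0}$ and [tge0] is
   $\mathcal{C}^{t\ge 0}$. *)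
Record t_structure := TStructure {
  tle0 : set C;
  tge0 : set C;
  tle0_isos : closed_under_isos tle0;
  tge0_isos : closed_under_isos tge0;
  tle0_shift : shift_class tle0 1 `<=` tle0;
  tge0_shift : tge0 `<=` shift_class tge0 1;
  t_orth : forall X Y, shift_class tle0 1 X -> tge0 Y ->
    forall f : mor X Y, f = 0;
  t_decomp : forall M : C,
    exists (L R : C) (f : mor L M) (g : mor M R) (h : mor R (shift L)),
      [/\ tle0 L, shift_class tge0 (-1) R & dist f g h]
}.

Definition tle (t : t_structure) (n : int) : set C :=
  shift_class (tle0 t) (- n).

Definition t_right_adjacent (t : t_structure) (w : weight_structure) : Prop :=
  tle0 t = wge0 w.

Definition t_cosmashing (t : t_structure) : Prop :=
  has_products C /\ closed_under_products (tle0 t).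

Definition t_cogenerated_by (t : t_structure) (P : set C) : Prop :=
  tle t (-1) = lperp P.

End Triangulated.

(* Main.v *)
Require Import Defs.
From HB Require Import structures.
From mathcomp Require Import all_boot all_order all_algebra.
From mathcomp Require Import ring_quotient generic_quotient boolp classical_sets.
Set Implicit Arguments.
Unset Strict Implicit.
Unset Printing Implicit Defensive.
Import GRing.Theory Num.Theory.
Local Open Scope classical_set_scope.
Local Open Scope quotient_scope.
Local Open Scope ring_scope.

(** Parts 1 to 3 are formal. Perpendicular classes of [Ps] and of [LO s] are both
    [RO s], dually for [Ps'], so weak symmetry of any such pair only says that
    [RO s = LO s']. If this common class exists, a morphism killed by all maps
    from [LO s] factors through an object of it, and so does a morphism killed
    by all maps to [RO s']; conversely such a factorisation is killed on both
    sides ([left_adjacent_symmetric]). Symmetry tested on identities gives weak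
    symmetry back.

    For parts 4 and 5, the group Q/Z is injective ([QmodZ_injective]) and
    detects nonzero elements ([QmodZ_cogenerator]). Injectivity makes
    Hom(C(p,-), Q/Z) cohomological, compactness of p makes it send coproducts to
    products, and Brown representability gives the dual of p. Detection gives
    C(p,X) = 0 iff C(X,p^) = 0, that is [rperp_lperp_bc_duals]. Perpendicular
    classes P^perp are closed under products always, and under coproducts if P
    consists of compact objects ([compact_rperp_coproducts]). Products in C
    come from Brown representability, applied to X |-> prod_i C(X, Y_i).

    The substance of part 5 is that A = C_(w>=0) is the aisle of a
    t-structure, although the class P need not be a set, so that no small
    object argument applies. The coreflection of an object M in A is obtained by
    representing a virtual truncation of C(-,M): for each X choose maps
    X -> R1 X -> R0 X which truncate X at w>=-1 and at w>=0, and put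
      F(X) = Im (C(R0 X, M) -> C(R1 X, M)).
    Any map X -> Y induces a unique map R1 X -> R0 Y, because R1 X -> R0 Y is
    determined by its restriction to X; this makes F a functor independent of
    the choices. It is cohomological since the cone of R1 X -> R0 Y lies again
    in A ([trunc_functor_cohomological]) and it converts coproducts to products
    since A is closed under coproducts ([trunc_functor_coproducts]). On A the
    functor F agrees with C(-,M), on C_(w>=-1) it embeds into C(-,M), and it
    vanishes on C_(w<=-1). Hence a representing object L belongs to A, and the
    cone of L -> M receives no nonzero map from A ([wge0_t_decomp]). *)

(** * Choice and additive maps *)

Lemma dependent_choice (I : Type) (T : I -> Type) (P : forall i, T i -> Prop) :
  (forall i, exists x, P i x) -> exists f, forall i, P i (f i).
Proof.
move=> exP; exists (fun i => projT1 (cid (exP i))) => i.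
exact: projT2 (cid (exP i)).
Qed.

Definition additive_of (A B : zmodType) (f : A -> B) (fB : zmod_morphism f) :
    {additive A -> B} :=
  HB.pack f (GRing.isZmodMorphism.Build A B f fB).

(** * Injectivity of Q/Z *)

Lemma QmodZ_divisible (q : QmodZ) n : (0 < n)%N -> exists z : QmodZ, z *+ n = q.
Proof.
move=> n_gt0; exists (\pi_QmodZ (repr q / n%:R)).
rewrite -raddfMn /= -[_ *+ n]mulr_natr mulfVK ?reprK //.
by rewrite pnatr_eq0 -lt0n.
Qed.

Lemma invn_QmodZ_neq0 n : (1 < n)%N -> \pi_QmodZ (n%:R^-1 : rat) != 0.
Proof.
move=> n_gt1; rewrite piE Quotient.equivE subr0.
apply/negP; rewrite unfold_in => /intrP[m em].
have n_neq0 : n%:R != 0 :> rat by rewrite pnatr_eq0 -lt0n ltnW.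
have : (m * n)%:~R = 1%:~R :> rat.
  by rewrite intrM -em -pmulrn mulVf.
move=> /intr_inj /(congr1 absz); rewrite abszM => /eqP.
by rewrite muln_eq1 => /andP[_ /eqP /= n1]; rewrite n1 in n_gt1.
Qed.

(** Euclidean division by the least positive element; the value n = 0 covers the
    zero subgroup. *)
Lemma int_subgroup_principal (I : set int) :
  I 0 -> (forall k l, I k -> I l -> I (k - l)) ->
  exists n : nat, forall k, I k <-> (n %| k)%Z.
Proof.
move=> I0 IB.
have IN k : I k -> I (- k) by rewrite -(sub0r k); apply: IB.
have IM k m : I k -> I (m * k).
  move=> Ik; have In n : I (n%:Z * k).
    elim: n => [|n IH]; first by rewrite mul0r.
    by rewrite intS mulrDl mul1r addrC -[X in _ + X]opprK; apply/IB/IN.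
  by case: m => n; rewrite ?NegzE ?mulNr; [apply: In | apply/IN/In].
have Iabs k : I k -> I `|k|%N.
  by move=> Ik; rewrite abszEsign; apply: IM.
case: (pselect (exists n, `[< (0 < n)%N /\ I n >])) => [exn|noI]; last first.
  exists 0%N => k; rewrite dvd0z; split=> [Ik|/eqP->//]; apply/eqP.
  apply: contra_notP noI => /eqP k_neq0; exists `|k|%N; apply/asboolP.
  by rewrite absz_gt0; split=> //; apply: Iabs.
case: (ex_minnP exn) => n /asboolP[n_gt0 In] n_min; exists n => k.
split=> [Ik|/dvdzP[m ->]]; last exact: IM.
have Ir : I (k %% n)%Z by rewrite /modz; apply: IB => //; apply: IM.
have r_lt : (k %% n)%Z < n by rewrite ltz_pmod.
have r_ge0 : 0 <= (k %% n)%Z by rewrite modz_ge0 // -lt0n.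
apply/dvdz_mod0P; move: Ir r_lt r_ge0; case: (k %% n)%Z => // -[|r] // Ir.
by rewrite ltz_nat ltnNge n_min //; apply/asboolP.
Qed.

Section InjectiveExtension.
Variables (B : zmodType).
Implicit Types (G : set (B * QmodZ)).

(** Graphs of partial homomorphisms to Q/Z: as sets of pairs they are ordered by
    inclusion, and unions of chains are again graphs, which is the form that
    Zorn's lemma takes here. *)
Definition additive_graph G : Prop :=
  [/\ G 0, forall s t, G s -> G t -> G (s - t)
    & forall q, G (0, q) -> q = 0].

Lemma pair_mulrz (x : B) (q : QmodZ) k : (x, q) *~ k = (x *~ k, q *~ k).
Proof.
have pair_mulrn (y : B * QmodZ) n : y *+ n = (y.1 *+ n, y.2 *+ n).
  by elim: n => // n IH; rewrite !mulrS IH.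
by case: k => n; rewrite ?NegzE ?mulrNz -?pmulrn pair_mulrn.
Qed.

Lemma graph_sub G x y q r :
  additive_graph G -> G (x, q) -> G (y, r) -> G (x - y, q - r).
Proof. by case=> _ GB _; apply: GB. Qed.

Lemma graph_multiple G x q k :
  additive_graph G -> G (x, q) -> G (x *~ k, q *~ k).
Proof.
move=> gG Gxq; have [G0 _ _] := gG.
have GN y r : G (y, r) -> G (- y, - r).
  by move=> /(graph_sub gG G0); rewrite !sub0r.
have Gn n : G (x *+ n, q *+ n).
  elim: n => [|n IH]; first by rewrite !mulr0n.
  rewrite !mulrSr -[X in (_ + X, _)]opprK -[X in (_, _ + X)]opprK.
  by apply/(graph_sub gG IH)/GN.
by case: k => n; rewrite ?NegzE ?mulrNz -!pmulrn; [apply: Gn | apply/GN/Gn].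
Qed.

(** The multiples of x in the domain of the graph are those of some n x. If n is
    positive, divisibility of Q/Z gives a value z at x with n z the prescribed
    value at n x; if n = 0 any z is compatible. *)
Lemma graph_value_at G x : additive_graph G ->
  exists z, forall k q, G (x *~ k, q) -> z *~ k = q.
Proof.
move=> gG; have [G0 GB Gf] := gG.
have [|k l [q Gq] [r Gr]|n nP] :=
    @int_subgroup_principal [set k | exists q, G (x *~ k, q)].
- by exists 0; rewrite mulr0z.
- by exists (q - r); rewrite mulrzBr; apply: graph_sub.
have [z zP] : exists z, forall q, G (x *~ n, q) -> z *~ n = q.
  have [q0 Gq0] : exists q0, G (x *~ n, q0) by apply/nP.
  have Gq q : G (x *~ n, q) -> q0 = q.
    move=> /(graph_sub gG Gq0); rewrite subrr => /Gf/eqP.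
    by rewrite subr_eq0 => /eqP.
  have [n0|n_gt0] := posnP n.
    by exists 0 => q; rewrite n0 mulr0z => /Gf->.
  have [z zn] := QmodZ_divisible q0 n_gt0.
  by exists z => q /Gq <-; rewrite -pmulrn.
exists z => k q Gk; have /nP/dvdzP[m km] : exists q, G (x *~ k, q) by exists q.
have [q0 Gq0] : exists q0, G (x *~ n, q0) by apply/nP.
have := graph_sub gG Gk (graph_multiple m gG Gq0).
rewrite km mulrC !mulrzA subrr (zP q0 Gq0) => /Gf/eqP.
by rewrite subr_eq0 => /eqP.
Qed.

Lemma graph_extend G x : additive_graph G ->
  exists2 H, additive_graph H /\ G `<=` H & exists q, H (x, q).
Proof.
move=> gG; have [G0 GB Gf] := gG; have [z zP] := graph_value_at x gG.
exists [set s | exists2 g, G g & exists k, s = g + (x, z) *~ k]; last first.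
  by exists z; exists 0 => //; exists 1; rewrite add0r.
split; last by move=> s Gs; exists s => //; exists 0; rewrite mulr0z addr0.
split=> [|_ _ [g Gg [k ->]] [h Gh [l ->]]|q [g Gg [k qE]]].
- by exists 0 => //; exists 0; rewrite mulr0z addr0.
- exists (g - h); first exact: GB.
  by exists (k - l); rewrite mulrzBr opprD addrACA.
have /zP : G (x *~ k, z *~ k - q).
  have := GB _ _ G0 Gg; rewrite sub0r; congr G.
  have -> : - g = (x, z) *~ k - (0, q) by rewrite qE opprD addrCA subrr addr0.
  by rewrite pair_mulrz -[_ - _]/(_ - _, _ - _) subr0.
by move/eqP; rewrite eq_sym -subr_eq0 addrC addKr oppr_eq0 => /eqP.
Qed.

End InjectiveExtension.

(** A maximal graph containing all pairs (j a, u a) is total by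
    [graph_extend]. Zorn's lemma is applied to the sets whose union with this
    initial graph is a graph, so that the empty chain causes no exception. *)
Lemma QmodZ_injective (A B : zmodType) (j : {additive A -> B})
    (u : {additive A -> QmodZ}) :
  (forall a, j a = 0 -> u a = 0) ->
  exists v : {additive B -> QmodZ}, forall a, v (j a) = u a.
Proof.
move=> ju; pose G0 := [set s | exists a, s = (j a, u a)].
have gG0 : additive_graph G0.
  split=> [|_ _ [a ->] [b ->]|q [a [ja ->]]].
  - by exists 0; rewrite !raddf0.
  - by exists (a - b); rewrite !raddfB.
  - by apply: ju.
have [F FP totF|G [gG maxG]] :=
    @Zorn_bigcup _ [set G | additive_graph (G `|` G0)].
  rewrite /=; set U := _ `|` G0.
  have UX X : F X -> X `|` G0 `<=` U.
    by move=> FX s [Xs|G0s]; [left; exists X | right].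
  have U2 s t : U s -> U t ->
      exists H, [/\ additive_graph H, H `<=` U, H s & H t].
    move=> [[X FX Xs]|G0s] [[Y FY Yt]|G0t].
    - case: (totF X Y FX FY) => [XY|YX].
        by exists (Y `|` G0); split; [exact: FP|exact: UX|left; exact: XY|left].
      by exists (X `|` G0); split; [exact: FP|exact: UX|left|left; exact: YX].
    - by exists (X `|` G0); split; [exact: FP|exact: UX|left|right].
    - by exists (Y `|` G0); split; [exact: FP|exact: UX|right|left].
    - by exists G0; split=> // s0 ?; right.
  split=> [|s t Us Ut|q Uq].
  - by right; case: gG0.
  - by have [H [[_ HB _] HU Hs Ht]] := U2 _ _ Us Ut; apply/HU/HB.
  - by have [H [[_ _ Hf] _ Hq _]] := U2 _ _ Uq Uq; apply: Hf.
set K := G `|` G0 in gG; have [K0 KB Kf] := gG.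
have Ktot x : exists q, K (x, q).
  have [H [gH KH] [q Hq]] := graph_extend x gG.
  have G0H : H `|` G0 = H.
    by apply/seteqP; split=> [s [//|G0s]|s Hs]; [apply: KH; right | left].
  case: (pselect (H `<=` G)) => [HG|nHG]; first by exists q; left; apply: HG.
  exfalso; apply: (maxG H); last by rewrite /= G0H.
  by split=> // s Gs; apply: KH; left.
have [v vP] := choice Ktot.
have Kfun x q q' : K (x, q) -> K (x, q') -> q = q'.
  move=> Kq /(KB _ _ Kq); rewrite -[_ - _]/(_ - _, _ - _) subrr => /Kf/eqP.
  by rewrite subr_eq0 => /eqP.
have vB : zmod_morphism v.
  move=> x y; apply: (Kfun (x - y)); first exact: vP.
  exact: (graph_sub gG (vP x) (vP y)).
by exists (additive_of vB) => a; apply: (Kfun (j a)); [exact: vP | right; exists a].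
Qed.

(** Send a to 1/m, where m is the order of a, or to 1/2 if a has infinite order;
    this is a homomorphism from Z a and it extends by injectivity. *)
Lemma QmodZ_cogenerator (A : zmodType) (a : A) :
  (forall u : {additive A -> QmodZ}, u a = 0) -> a = 0.
Proof.
apply: contraPP => /eqP a_neq0 all0.
suff [q q_neq0 qP] : exists2 q : QmodZ, q != 0 & forall k : int, a *~ k = 0 -> q *~ k = 0.
  pose j := additive_of (fun k l => mulrzBr a k l).
  pose u := additive_of (fun k l => mulrzBr q k l).
  have [v vP] := @QmodZ_injective _ _ j u qP.
  by have := vP 1; rewrite /= !mulr1z all0 => /esym/eqP; apply/negP.
have [|k l ak al|n nP] := @int_subgroup_principal [set k | a *~ k = 0].
- exact: mulr0z.
- by rewrite /= mulrzBr ak al subr0.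
(* n is the order of a, zero if infinite; n = 1 is excluded by a != 0. *)
have [m m_gt1 mP] : exists2 m : nat, (1 < m)%N & forall k, (n %| k)%Z -> (m %| k)%Z.
  case: n nP => [|[|n]] nP; last by exists n.+2.
    by exists 2 => // k; rewrite dvd0z => /eqP->.
  by have /nP/= : (1%N %| 1)%Z by []; rewrite mulr1z => a0; rewrite a0 eqxx in a_neq0.
exists (\pi_QmodZ (m%:R^-1)); first exact: invn_QmodZ_neq0.
move=> k /nP/mP/dvdzP[l ->]; rewrite mulrC mulrzA -pmulrn -raddfMn /=.
have m_neq0 : m%:R != 0 :> rat by rewrite pnatr_eq0 -lt0n ltnW.
suff -> : \pi_QmodZ (m%:R^-1 *+ m : rat) = 0 by rewrite mul0rz.
apply/eqP; rewrite piE Quotient.equivE subr0 unfold_in.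
by rewrite -[_^-1 *+ m]mulr_natr mulVf.
Qed.

(** * Perpendicular classes *)

Section Preadditive.
Variable C : preadditive.
Implicit Types X Y Z W : C.

Lemma mcomp0 X Y Z (g : mor Y Z) : g \c (0 : mor X Y) = 0.
Proof. exact: raddf0 (post X g). Qed.

Lemma mcompN X Y Z (g : mor Y Z) (f : mor X Y) : g \c (- f) = - (g \c f).
Proof. exact: raddfN (post X g) f. Qed.

Lemma mcompBl X Y Z (g g' : mor Y Z) (f : mor X Y) :
  (g - g') \c f = g \c f - g' \c f.
Proof. by apply/eqP; rewrite eq_sym subr_eq -mcompDl subrK. Qed.

Lemma mcomp0l X Y Z (f : mor X Y) : (0 : mor Y Z) \c f = 0.
Proof. by rewrite -[0](subrr 0) mcompBl subrr. Qed.

Lemma mcompNl X Y Z (g : mor Y Z) (f : mor X Y) : (- g) \c f = - (g \c f).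
Proof. by rewrite -[- g]sub0r mcompBl mcomp0l sub0r. Qed.

Lemma iso_retract X Y : isomorphic X Y -> retract X Y.
Proof. by case=> f [g [gf fg]]; exists f, g. Qed.

Lemma isomorphic_sym X Y : isomorphic X Y -> isomorphic Y X.
Proof. by case=> f [g [gf fg]]; exists g, f. Qed.

Lemma isomorphic_refl X : isomorphic X X.
Proof. by exists (idm X), (idm X); rewrite mcomp1m. Qed.

Lemma rperp_retract (S : set C) : closed_under_retracts (rperp S).
Proof.
move=> X Y [i [r ri]] SY P SP f.
by rewrite -[f]mcomp1m -ri -mcompA (SY P SP (i \c f)) mcomp0.
Qed.

Lemma rperp_products (S : set C) : closed_under_products (rperp S).
Proof.
move=> I X L proj prodL SX P SP f.
have [g [_ g_uniq]] := prodL P (fun=> 0).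
rewrite -(g_uniq f) => [|i]; last exact: SX SP _.
by apply: g_uniq => i; rewrite mcomp0.
Qed.

Lemma sub_rperp_lperp (S : set C) : S `<=` rperp (lperp S).
Proof. by move=> X SX P; apply. Qed.

(** C(P,T) is the coproduct of zero groups, so its identity and zero
    endomorphisms agree. *)
Lemma compact_rperp_coproducts (S : set C) :
  S `<=` @compact C -> closed_under_coproducts (rperp S).
Proof.
move=> Scpt I X T inj copT SX P SP f.
have [g [_ g_uniq]] := Scpt P SP I X T inj copT (mor P T) (fun i => \0).
have inj0 i x : inj i \c x = 0 :> mor P T by rewrite (SX i P SP x) mcomp0.
have g_id : g = idfun by apply: g_uniq => i x; exact: inj0.
have g_0 : g = \0 by apply: g_uniq.
by rewrite -[f]/(idfun f) -[idfun f]/((idfun : {additive _ -> _}) f) -g_id g_0.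
Qed.

Lemma null_idm (S : set C) X : null S (idm X) <-> rperp S X.
Proof. by split=> H M SM f; move: (H M SM f); rewrite mcomp1m. Qed.

Lemma conull_idm (S : set C) X : conull S (idm X) <-> lperp S X.
Proof. by split=> H M SM f; move: (H M SM f); rewrite mcompm1. Qed.

Lemma symmetric_weakly_symmetric (P P' : set C) :
  symmetric_to P P' -> weakly_symmetric P P'.
Proof.
by move=> sym; apply/seteqP; split=> X; rewrite -null_idm -conull_idm sym.
Qed.

End Preadditive.

(** * Shift and exact triangles *)

Section Equivalence.
Variables (C D : preadditive) (F : functor C D) (G : functor D C).

Hypothesis GF1 : naturally_isomorphic (functor_comp G F) (functor_id C).

Lemma faithful_of_left_inverse (X Y : C) (f g : mor X Y) :
  fmap F f = fmap F g -> f = g.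
Proof.
case: GF1 => phi [phi_iso phi_nat] Ffg.
have [psi [_ phipsi]] := phi_iso X.
have := phi_nat X Y f; have := phi_nat X Y g; rewrite /= Ffg => <- fg.
by rewrite -[f]mcompm1 -[g]mcompm1 -phipsi !mcompA fg.
Qed.

End Equivalence.

Section Triangulated.
Variable C : triangulated.
Implicit Types X Y Z W : C.

Lemma shift_faithful X Y (f g : mor X Y) :
  fmap shift f = fmap shift g -> f = g.
Proof. exact: (faithful_of_left_inverse (@shiftK C)). Qed.

Lemma unshift_faithful X Y (f g : mor X Y) :
  fmap unshift f = fmap unshift g -> f = g.
Proof. exact: (faithful_of_left_inverse (@unshiftK C)). Qed.

(** Conjugating g[-1] by the isomorphisms X[1][-1] = X produces f with
    f[1][-1] = g[-1], and the inverse shift is itself faithful. *)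
Lemma shift_full X Y (g : mor (shift X) (shift Y)) :
  exists f, fmap shift f = g.
Proof.
have [phi [phi_iso phi_nat]] := @shiftK C.
have [psi [psiphi phipsi]] := phi_iso X.
have [chi [chiphi _]] := phi_iso Y.
exists (phi Y \c fmap unshift g \c psi); apply: unshift_faithful.
set f := _ \c psi; have /= := phi_nat X Y f.
rewrite /f -(mcompA (_ \c _)) psiphi mcompm1 => /(congr1 (mcomp chi)).
by rewrite !mcompA chiphi !mcomp1m.
Qed.

Lemma shift_inj0 X Y (f : mor X Y) : fmap shift f = 0 -> f = 0.
Proof. by rewrite -(raddf0 (fmap shift)) => /shift_faithful. Qed.

Lemma shift_unshift X : isomorphic (shift (unshift X)) X.
Proof. by have [phi [phi_iso _]] := @unshiftK C; exists (phi X); exact: phi_iso. Qed.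

Lemma unshift_shift X : isomorphic (unshift (shift X)) X.
Proof. by have [phi [phi_iso _]] := @shiftK C; exists (phi X); exact: phi_iso. Qed.

Lemma shift_reflects_retract X Y : retract (shift X) (shift Y) -> retract X Y.
Proof.
case=> i [r ri]; have [i' i'E] := shift_full i; have [r' r'E] := shift_full r.
by exists i', r'; apply: shift_faithful; rewrite fmapM i'E r'E ri fmap1.
Qed.

Lemma shift_coproduct (I : small) (X : I -> C) S (inj : forall i, mor (X i) S) :
  coproduct inj -> coproduct (fun i => fmap shift (inj i)).
Proof.
move=> copS Y f.
have [e [e' [e'e ee']]] := shift_unshift Y.
have [f' f'E] := dependent_choice (fun i => shift_full (e' \c f i)).
have [g [gE g_uniq]] := copS _ f'; exists (e \c fmap shift g); split=> [i|h hE].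
  by rewrite -mcompA -fmapM gE f'E mcompA ee' mcomp1m.
have [h' h'E] := shift_full (e' \c h).
have -> : g = h'.
  apply: g_uniq => i; apply: shift_faithful.
  by rewrite fmapM h'E -mcompA hE f'E.
by rewrite h'E mcompA ee' mcomp1m.
Qed.

Lemma functor_is_zero (F : functor C C) Z : is_zero Z -> is_zero (F Z).
Proof.
case=> _ Z0; have F1 : idm (F Z) = 0 by rewrite -fmap1 (Z0 _ (idm Z)) raddf0.
by split=> X f; [rewrite -[f]mcomp1m F1 mcomp0l | rewrite -[f]mcompm1 F1 mcomp0].
Qed.

Section Triangle.
Variables (X Y Z : C) (f : mor X Y) (g : mor Y Z) (h : mor Z (shift X)).
Hypothesis fgh : dist f g h.

Lemma dist_comp0 : g \c f = 0.
Proof.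
have [[O O0] _] := tri_additive C.
have [|c [c0 _]] := tr3 (a := idm X) (b := f) (tr1_id X O0) fgh; first by [].
by rewrite -c0 mcomp0.
Qed.

(** Compare the triangle with 0 -> W = W -> 0. *)
Lemma dist_weak_cokernel W (a : mor Y W) : a \c f = 0 -> exists b, b \c g = a.
Proof.
move=> af0; have [[O O0] _] := tri_additive C.
have W1 : dist (0 : mor O W) (idm W) 0.
  have shO0 := functor_is_zero shift O0.
  by rewrite tr2 raddf0 oppr0; apply: tr1_id.
have [|c [cE _]] := tr3 (a := 0) (b := a) fgh W1.
  by rewrite af0 mcomp0.
by exists c; rewrite cE mcomp1m.
Qed.

(** Compare the rotated triangle with the rotation of W = W -> 0; the filling map
    is a map of suspensions, hence the need for fullness of the shift. *)
Lemma dist_weak_kernel W (a : mor W Y) : g \c a = 0 -> exists b, f \c b = a.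
Proof.
move=> ga0; have [[O O0] _] := tri_additive C.
have W1 : dist (0 : mor W O) 0 (- fmap shift (idm W)) by rewrite -tr2; apply: tr1_id.
have gh : dist g h (- fmap shift f) by rewrite -tr2.
have [|c [_ cE]] := tr3 (a := a) (b := 0) W1 gh; first by rewrite ga0 mcomp0.
have [b bE] := shift_full c; exists b; apply: shift_faithful.
move: cE; rewrite mcompN mcompNl fmap1 mcompm1 -bE -fmapM => /oppr_inj->.
by [].
Qed.

End Triangle.

Lemma rperp_extension (S : set C) X Y Z (f : mor X Y) (g : mor Y Z)
    (h : mor Z (shift X)) :
  dist f g h -> rperp S X -> rperp S Z -> rperp S Y.
Proof.
move=> fgh SX SZ P SP a; have [b <-] := dist_weak_kernel fgh (SZ P SP (g \c a)).
by rewrite (SX P SP b) mcomp0.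
Qed.

(** Both conditions on a morphism say that it factors through an object of
    RO s = LO s': an LO-null morphism extends over X -> R, an RO'-conull one lifts
    through L -> Y. *)
Lemma left_adjacent_symmetric (s s' : torsion_pair C) :
  left_adjacent s s' -> symmetric_to (LO s) (RO s').
Proof.
move=> adj X Y a; split=> aP.
  have [L [R [f [g [h [LL RR fgh]]]]]] := torsion_decomp s X.
  have [b <-] := dist_weak_cokernel fgh (aP L LL f).
  move=> M M_RO c; rewrite mcompA.
  have : lperp (RO s') R by rewrite -torsion_lperp -adj.
  by move=> /(_ M M_RO (c \c b))->; rewrite mcomp0l.
have [L [R [f [g [h [LL RR fgh]]]]]] := torsion_decomp s' Y.
have [b <-] := dist_weak_kernel fgh (aP R RR g).
move=> M M_LO c; rewrite -mcompA.
have : rperp (LO s) L by rewrite torsion_rperp adj.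
by move=> /(_ M M_LO (b \c c))->; rewrite mcomp0.
Qed.

End Triangulated.

(** * Products and Brown-Comenetz duals *)

(** A separate name for the product group keeps its structure apart from those that
    plain function types may carry. *)
Definition family_of (I : Type) (A : I -> zmodType) : Type := forall i, A i.

Section FamilyZmodule.
Variables (I : Type) (A : I -> zmodType).
Local Notation T := (family_of A).

HB.instance Definition _ := gen_eqMixin T.
HB.instance Definition _ := gen_choiceMixin T.

Lemma family_ext (x y : T) : (forall i, x i = y i) -> x = y.
Proof. exact: functional_extensionality_dep. Qed.

Definition family0 : T := fun i => 0.
Definition familyN (x : T) : T := fun i => - x i.
Definition familyD (x y : T) : T := fun i => x i + y i.

Lemma familyDA : associative familyD.
Proof. by move=> x y z; apply: family_ext => i; apply: addrA. Qed.

Lemma familyDC : commutative familyD.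
Proof. by move=> x y; apply: family_ext => i; apply: addrC. Qed.

Lemma family0D : left_id family0 familyD.
Proof. by move=> x; apply: family_ext => i; apply: add0r. Qed.

Lemma familyND : left_inverse family0 familyN familyD.
Proof. by move=> x; apply: family_ext => i; apply: addNr. Qed.

HB.instance Definition _ :=
  GRing.isZmodule.Build T familyDA familyDC family0D familyND.

End FamilyZmodule.

Section ProductFunctor.
Variables (C : preadditive) (I : small) (Y : I -> C).

Definition hom_family (X : C) : zmodType := family_of (fun i => mor X (Y i)).

Section Pre.
Variables (X X' : C) (f : mor X X').

Definition family_pre (x : hom_family X') : hom_family X := fun i => x i \c f.

Lemma family_pre_zmod_morphism : zmod_morphism family_pre.
Proof. by move=> x y; apply: family_ext => i; apply: mcompBl. Qed.

Definition family_map : {additive hom_family X' -> hom_family X} :=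
  additive_of family_pre_zmod_morphism.
End Pre.

Lemma family_map1 X x : family_map (idm X) x = x.
Proof. by apply: family_ext => i; apply: mcompm1. Qed.

Lemma family_mapM X X' X'' (g : mor X' X'') (f : mor X X') x :
  family_map (g \c f) x = family_map f (family_map g x).
Proof. by apply: family_ext => i; apply: mcompA. Qed.

Lemma family_mapD X X' (f g : mor X X') x :
  family_map (f + g) x = family_map f x + family_map g x.
Proof. by apply: family_ext => i; apply: mcompDr. Qed.

Definition product_functor : cofunctor C :=
  Cofunctor family_map1 family_mapM family_mapD.

Lemma product_functor_coproducts : coproducts_to_products product_functor.
Proof.
move=> J X S inj copS x.
have [y yP] := dependent_choice (fun i => copS (Y i) (fun j => x j i)).
exists y; split=> [j|z zE]; apply: family_ext => i; have [yE y_uniq] := yP i.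
  exact: yE.
by apply: y_uniq => j; rewrite -zE.
Qed.

End ProductFunctor.

Section Brown.
Variable C : triangulated.
Implicit Types X Y Z : C.

Lemma product_functor_cohomological (I : small) (Y : I -> C) :
  cohomological (product_functor Y).
Proof.
move=> X1 X2 X3 f g h fgh y; split=> [yf|[z <-]].
  have yf0 i : y i \c f = 0 by rewrite -[LHS]/(comap (product_functor Y) f y i) yf.
  have [z zE] := dependent_choice (fun i => dist_weak_cokernel fgh (yf0 i)).
  by exists z; apply: family_ext.
apply: family_ext => i; rewrite -[LHS]/(z i \c g \c f) -mcompA.
by rewrite (dist_comp0 fgh) mcomp0.
Qed.

Lemma brown_has_products : brown_representability C -> has_products C.
Proof.
case=> _ brown I Y.
have [S [phi [phi_bij phi_nat]]] := brown _ (@product_functor_cohomological I Y)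
  (@product_functor_coproducts C I Y).
exists S, (phi S (idm S)).
have phiE X (g : mor X S) i : phi X g i = phi S (idm S) i \c g.
  by rewrite -{1}[g]mcomp1m phi_nat.
move=> X f; have [psi phiK psiK] := phi_bij X.
exists (psi f); split=> [i|g gE]; first by rewrite -phiE psiK.
by rewrite -[g]phiK; congr psi; apply: family_ext => i; rewrite phiE gE.
Qed.

(** If u : C(p,Y) -> Q/Z vanishes on the image of C(p,X), it vanishes on the kernel
    of C(p,Y) -> C(p,Z), and injectivity of Q/Z extends it from the image to all
    of C(p,Z). *)
Lemma bc_functor_cohomological (p : C) : cohomological (bc_functor p).
Proof.
move=> X Y Z f g h fgh u; split=> [uf|[v <-]]; last first.
  by apply: additive_ext => x; rewrite /= mcompA (dist_comp0 fgh) mcomp0l raddf0.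
have [|v vP] := @QmodZ_injective _ _ (post p g) u.
  move=> a /(dist_weak_kernel fgh)[b <-].
  by rewrite -[LHS]/(comap (bc_functor p) f u b) uf.
by exists v; apply: additive_ext.
Qed.

Lemma bc_functor_coproducts (p : C) :
  compact p -> coproducts_to_products (bc_functor p).
Proof.
move=> pcpt I X S inj copS u.
have [v [vE v_uniq]] := pcpt I X S inj copS QmodZ u.
exists v; split=> [i|w wE]; first by apply: additive_ext => x; apply: vE.
by apply: v_uniq => i x; rewrite -wE.
Qed.

Lemma compact_have_bc_duals (P : set C) :
  brown_representability C -> P `<=` @compact C -> have_bc_duals P.
Proof.
case=> _ brown Pcpt p Pp; apply: brown; first exact: bc_functor_cohomological.
exact/bc_functor_coproducts/Pcpt.
Qed.

(** C(X, p^) is the character group of C(p,X), and a group without nonzero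
    characters to Q/Z is zero. *)
Lemma rperp_lperp_bc_duals (P : set C) :
  have_bc_duals P -> rperp P = lperp (bc_duals P).
Proof.
move=> dualP; apply/seteqP; split=> X.
  move=> PX ph [p Pp [phi [phi_bij _]]] f; apply: (bij_inj (phi_bij X)).
  by rewrite raddf0; apply: additive_ext => x; rewrite (PX p Pp x) raddf0.
move=> dX p Pp x; have [ph p_ph] := dualP p Pp.
have [phi [phi_bij _]] := p_ph; have [psi _ psiK] := phi_bij X.
apply: QmodZ_cogenerator => u; rewrite -[u]psiK.
by rewrite (dX ph _ (psi u)) ?raddf0 //; exists p.
Qed.

End Brown.

(** * Virtual truncations of representable functors *)

Section WeakReflections.
Variable C : triangulated.
Implicit Types (X Y Z W M : C) (K D : set C).

Definition weakly_reflects K X W (r : mor X W) : Prop :=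
  K W /\ forall Y, K Y -> forall f : mor X Y, exists g, g \c r = f.

Definition epic_into D X W (r : mor X W) : Prop :=
  forall Y, D Y -> forall k : mor W Y, k \c r = 0 -> k = 0.

(** K[-1]; when K is C_(w>=0) this is C_(w>=-1). *)
Definition desuspension K : set C := [set X | K (shift X)].

(** Here A plays C_(w>=0), and the maps [r0 X : X -> R0 X], [r1 X : X -> R1 X] play
    the weight truncations of X at w>=0 and at w>=-1. Neither is functorial by
    itself; [r1_epic] makes the maps from one level to the next unique. *)
Section VirtualTruncation.
Variable A : set C.
Local Notation A1 := (desuspension A).
Hypothesis A_biperp : rperp (lperp A) `<=` A.
Hypothesis A_sub : A `<=` A1.
Hypothesis A_coprod : closed_under_coproducts A.
Hypothesis C_coprod : has_coproducts C.

Variables (R0 R1 : C -> C).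
Variables (r0 : forall X, mor X (R0 X)) (r1 : forall X, mor X (R1 X)).
Hypothesis r0P : forall X, weakly_reflects A (r0 X).
Hypothesis r1P : forall X, weakly_reflects A1 (r1 X).
Hypothesis r1_epic : forall X, epic_into A (r1 X).

Lemma r1_cancel X Y (k k' : mor (R1 X) Y) :
  A Y -> k \c r1 X = k' \c r1 X -> k = k'.
Proof.
move=> AY /eqP; rewrite -subr_eq0 -mcompBl => /eqP/(r1_epic AY)/eqP.
by rewrite subr_eq0 => /eqP.
Qed.

(** Two truncation levels are used so that a morphism X -> Y induces a unique map
    R1 X -> R0 Y; maps R0 X -> R0 Y or R1 X -> R1 Y over it exist but
    need not be unique. *)
Lemma trunc_map_ex X Y (f : mor X Y) :
  exists u : mor (R1 X) (R0 Y), u \c r1 X = r0 Y \c f.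
Proof. by apply: (r1P X).2; apply/A_sub/(r0P Y).1. Qed.

Definition trunc_map X Y (f : mor X Y) := projT1 (cid (trunc_map_ex f)).

Lemma trunc_mapE X Y (f : mor X Y) : trunc_map f \c r1 X = r0 Y \c f.
Proof. exact: projT2 (cid (trunc_map_ex f)). Qed.

Lemma trunc_map_uniq X Y (f : mor X Y) u :
  u \c r1 X = r0 Y \c f -> u = trunc_map f.
Proof. by move=> uE; apply: r1_cancel; [exact: (r0P Y).1 | rewrite trunc_mapE]. Qed.

Lemma lift1_ex X Y (f : mor X Y) :
  exists v : mor (R1 X) (R1 Y), v \c r1 X = r1 Y \c f.
Proof. exact: (r1P X).2 (r1P Y).1 _. Qed.

Definition lift1 X Y (f : mor X Y) := projT1 (cid (lift1_ex f)).

Lemma lift1E X Y (f : mor X Y) : lift1 f \c r1 X = r1 Y \c f.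
Proof. exact: projT2 (cid (lift1_ex f)). Qed.

Lemma lift0_ex X Y (f : mor X Y) :
  exists w : mor (R0 X) (R0 Y), w \c r0 X = r0 Y \c f.
Proof. exact: (r0P X).2 (r0P Y).1 _. Qed.

Local Notation c X := (trunc_map (idm X)).

Lemma connecting_mapE X : c X \c r1 X = r0 X.
Proof. by rewrite trunc_mapE mcompm1. Qed.

(** All choices of lifts R1 X -> R1 Y agree after the connecting map to R0 Y, and
    elements of the truncation factor through that map. *)
Lemma trunc_map_lift X Y (f : mor X Y) v :
  v \c r1 X = r1 Y \c f -> c Y \c v = trunc_map f.
Proof. by move=> vE; apply: trunc_map_uniq; rewrite -mcompA vE mcompA connecting_mapE. Qed.

Section Functor.
Variable M : C.

(** The image of C(R0 X, M) in C(R1 X, M). *)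
Definition trunc_pred X : {pred mor (R1 X) M} :=
  fun phi => `[< exists psi, psi \c c X = phi >].
Arguments trunc_pred : clear implicits.

Lemma trunc_predP X phi :
  reflect (exists psi, psi \c c X = phi) (phi \in trunc_pred X).
Proof. exact: asboolP. Qed.

Lemma trunc_pred_zmod_closed X : zmod_closed (trunc_pred X).
Proof.
split=> [|_ _ /trunc_predP[psi <-] /trunc_predP[chi <-]]; apply/trunc_predP.
  by exists 0; rewrite mcomp0l.
by exists (psi - chi); rewrite mcompBl.
Qed.

HB.instance Definition _ X :=
  GRing.isZmodClosed.Build _ (trunc_pred X) (trunc_pred_zmod_closed X).

Definition trunc X : Type := {phi : mor (R1 X) M | phi \in trunc_pred X}.

HB.instance Definition _ X := SubType.on (trunc X).
HB.instance Definition _ X := [Choice of trunc X by <:].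
HB.instance Definition _ X := [SubChoice_isSubZmodule of trunc X by <:].

Lemma truncP X (phi : trunc X) : exists psi, psi \c c X = val phi.
Proof. exact/trunc_predP/(valP phi). Qed.

Definition trunc_of X psi : trunc X :=
  Sub (psi \c c X) (introT (trunc_predP _) (ex_intro _ psi erefl)).

Lemma trunc_comp_mem X Y (f : mor X Y) (phi : trunc Y) :
  val phi \c lift1 f \in trunc_pred X.
Proof.
have [psi <-] := truncP phi; have [w wE] := lift0_ex f.
apply/trunc_predP; exists (psi \c w); rewrite -!mcompA; congr mcomp.
rewrite (trunc_map_lift (lift1E f)); apply: trunc_map_uniq.
by rewrite -mcompA connecting_mapE.
Qed.

Definition trunc_comp X Y (f : mor X Y) (phi : trunc Y) : trunc X :=
  Sub (val phi \c lift1 f) (trunc_comp_mem f phi).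

Lemma trunc_comp_zmod_morphism X Y (f : mor X Y) : zmod_morphism (trunc_comp f).
Proof. by move=> x y; apply: val_inj; rewrite raddfB /= mcompBl. Qed.

Definition trunc_comap X Y (f : mor X Y) : {additive trunc Y -> trunc X} :=
  additive_of (trunc_comp_zmod_morphism f).

Lemma trunc_comapE X Y (f : mor X Y) (phi : trunc Y) v :
  v \c r1 X = r1 Y \c f -> val (trunc_comap f phi) = val phi \c v.
Proof.
move=> vE /=; have [psi <-] := truncP phi.
by rewrite -!mcompA (trunc_map_lift (lift1E f)) (trunc_map_lift vE).
Qed.

Lemma trunc_comap1 X phi : trunc_comap (idm X) phi = phi.
Proof.
by apply: val_inj; rewrite (@trunc_comapE _ _ _ _ (idm _)) ?mcompm1 ?mcomp1m.
Qed.

Lemma trunc_comapM X Y Z (g : mor Y Z) (f : mor X Y) phi :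
  trunc_comap (g \c f) phi = trunc_comap f (trunc_comap g phi).
Proof.
apply: val_inj; rewrite (@trunc_comapE _ _ _ _ (lift1 g \c lift1 f)).
  by rewrite mcompA.
by rewrite -mcompA lift1E mcompA lift1E -mcompA.
Qed.

Lemma trunc_comapD X Y (f g : mor X Y) phi :
  trunc_comap (f + g) phi = trunc_comap f phi + trunc_comap g phi.
Proof.
apply: val_inj; rewrite (@trunc_comapE _ _ _ _ (lift1 f + lift1 g)).
  by rewrite mcompDr raddfD.
by rewrite mcompDl mcompDr !lift1E.
Qed.

Definition trunc_functor : cofunctor C :=
  Cofunctor trunc_comap1 trunc_comapM trunc_comapD.

Lemma trunc_comap_trunc_map X Y (f : mor X Y) (phi : trunc Y) psi :
  psi \c c Y = val phi -> val (trunc_comap f phi) = psi \c trunc_map f.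
Proof. by move=> psiE; rewrite /= -psiE -mcompA (trunc_map_lift (lift1E f)). Qed.

(** An element psi over Y killed in F(X) factors through the cone K of the induced
    map R1 X -> R0 Y. As an extension of R1 X [1] by R0 Y, the object K is in A, so
    the map Z -> K given by the morphism of triangles factors through R0 Z, and
    this yields the required element of F(Z). *)
Lemma trunc_functor_cohomological : cohomological trunc_functor.
Proof.
move=> X Y Z f g h fgh phi; split=> [phif|[z <-]]; last first.
  rewrite -comapM (dist_comp0 fgh); apply: (addrI (comap trunc_functor 0 z)).
  by rewrite -comapD !addr0.
have [psi psiE] := truncP phi.
have psi_f0 : psi \c trunc_map f = 0.
  by rewrite -(trunc_comap_trunc_map f psiE) (phif : trunc_comap f phi = 0) raddf0.
have [K [k [l fkl]]] := tr1_cone (trunc_map f).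
have AK : A K.
  apply: A_biperp; have kl := fkl; rewrite tr2 in kl.
  apply: rperp_extension kl _ _; apply: sub_rperp_lperp; first exact: (r0P Y).1.
  exact: (r1P X).1.
have [kappa kappaE] := dist_weak_cokernel fkl psi_f0.
have [z [zg _]] := tr3 fgh fkl (esym (trunc_mapE f)).
have [j jE] := (r0P Z).2 K AK z.
exists (trunc_of (kappa \c j)); apply: val_inj.
rewrite (@trunc_comap_trunc_map _ _ g _ (kappa \c j)) // -psiE -kappaE.
rewrite -!mcompA; congr mcomp; apply: r1_cancel => //.
by rewrite -!mcompA trunc_mapE connecting_mapE mcompA jE.
Qed.

(** The coproducts T0 of the R0 (X i) and T1 of the R1 (X i) need not be the chosen
    truncations of S, but S -> T0 factors through R0 S, which gives existence, and
    S -> T1 factors through R1 S, which gives uniqueness. *)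
Lemma trunc_functor_coproducts : coproducts_to_products trunc_functor.
Proof.
move=> I X S inj copS phi.
have [psi psiE] := dependent_choice (fun i => truncP (phi i)).
have [T0 [in0 copT0]] := C_coprod (fun i => R0 (X i)).
have [T1 [in1 copT1]] := C_coprod (fun i => R1 (X i)).
have AT0 : A T0 by apply: A_coprod copT0 _ => i; exact: (r0P (X i)).1.
have AT1 : A1 T1.
  by apply: A_coprod (shift_coproduct copT1) _ => i; exact: (r1P (X i)).1.
have [Psi [PsiE _]] := copT0 M psi.
have [s0 [s0E _]] := copS T0 (fun i => in0 i \c r0 (X i)).
have [s1 [s1E _]] := copS T1 (fun i => in1 i \c r1 (X i)).
have [j0 j0E] := (r0P S).2 T0 AT0 s0.
have [j1 j1E] := (r1P S).2 T1 AT1 s1.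
have [u [uE _]] := copT1 (R0 S) (fun i => trunc_map (inj i)).
pose y := trunc_of (Psi \c j0).
have inj0 (y' : trunc S) : (forall i, trunc_comap (inj i) y' = 0) -> y' = 0.
  move=> y0; have [chi chiE] := truncP y'.
  have chi_u : chi \c u = 0.
    have [v [_ v_uniq]] := copT1 M (fun=> 0).
    have <- : v = chi \c u.
      by apply: v_uniq => i; rewrite -mcompA uE -(trunc_comap_trunc_map _ chiE) y0.
    by apply: v_uniq => i; rewrite mcomp0l.
  have u_s1 : u \c s1 = r0 S.
    have [v [_ v_uniq]] := copS (R0 S) (fun i => r0 S \c inj i).
    have <- : v = u \c s1.
      by apply: v_uniq => i; rewrite -mcompA s1E mcompA uE trunc_mapE.
    exact: v_uniq.
  have u_j1 : u \c j1 = c S.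
    apply: r1_cancel; first exact: (r0P S).1.
    by rewrite -mcompA j1E u_s1 connecting_mapE.
  by apply: val_inj; rewrite -chiE -u_j1 mcompA chi_u mcomp0l raddf0.
have yE i : trunc_comap (inj i) y = phi i.
  apply: val_inj; rewrite (@trunc_comap_trunc_map _ _ _ _ (Psi \c j0)) //.
  rewrite -psiE -PsiE -!mcompA; congr mcomp; apply: r1_cancel => //.
  by rewrite -!mcompA trunc_mapE connecting_mapE mcompA j0E s0E.
exists y; split=> // z zE; apply/eqP; rewrite -subr_eq0; apply/eqP/inj0.
by move=> i; rewrite raddfB yE -zE subrr.
Qed.

(** The three properties of L -> M reflect the values of F: it vanishes on objects
    without nonzero maps to A, so that L is in A; it is all of C(-,M) on A; it
    embeds into C(-,M) on A[-1]. *)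
Lemma brown_coreflection :
  (forall H : cofunctor C,
     cohomological H -> coproducts_to_products H -> representable H) ->
  exists L (e : mor L M),
    [/\ A L, forall X, A X -> forall m : mor X M, exists g, e \c g = m
      & forall X, A1 X -> forall g : mor X L, e \c g = 0 -> g = 0].
Proof.
move=> /(_ _ trunc_functor_cohomological trunc_functor_coproducts).
case=> L [phi [phi_bij phi_nat]].
pose e := val (phi L (idm L)) \c r1 L.
have phiE X (g : mor X L) : val (phi X g) \c r1 X = e \c g.
  rewrite -{1}[g]mcomp1m phi_nat -[comap _ _ _]/(trunc_comap _ _) /=.
  by rewrite -mcompA lift1E mcompA.
exists L, e; split=> [|X AX m|X A1X g eg0].
- apply: A_biperp => X AX g; apply: (bij_inj (phi_bij X)); rewrite raddf0.
  apply: val_inj; have [psi <-] := truncP (phi X g).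
  suff -> : c X = 0 by rewrite mcomp0 raddf0.
  apply: (r1_epic (r0P X).1).
  by rewrite connecting_mapE; apply: AX; exact: (r0P X).1.
- have [q qE] := (r0P X).2 X AX (idm X).
  have [psi _ psiK] := phi_bij X; exists (psi (trunc_of (m \c q))).
  by rewrite -phiE psiK /= -mcompA connecting_mapE -mcompA qE mcompm1.
apply: (bij_inj (phi_bij X)); rewrite raddf0; apply: val_inj.
have [q qE] := (r1P X).2 X A1X (idm X).
have [psi psiE] := truncP (phi X g).
(* X is a retract of R1 X, and the connecting map ignores the complement. *)
have cX : c X \c r1 X \c q = c X.
  by apply: r1_cancel; [exact: (r0P X).1 | rewrite -!mcompA qE mcompm1].
by rewrite -psiE -cX !mcompA psiE phiE eg0 mcomp0l raddf0.
Qed.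

End Functor.
End VirtualTruncation.
End WeakReflections.

(** * The t-structure adjacent to a weight structure *)

Section WeightStructure.
Variables (C : triangulated) (w : weight_structure C).
Local Notation A := (wge0 w).
Implicit Types X Y Z W L R M : C.

Lemma wge0_isomorphic X Y : isomorphic X Y -> A Y -> A X.
Proof. by move=> /iso_retract; apply: wge0_retracts. Qed.

Lemma shift_class1 (K : set C) X : K X -> shift_class K 1 (shift X).
Proof. by move=> KX; exists X => //; apply: isomorphic_refl. Qed.

Lemma wge0_sub_desuspension : A `<=` desuspension A.
Proof. by move=> X AX; apply: wge0_shift; apply: shift_class1. Qed.

Lemma wge0_unshift X : A X -> desuspension A (unshift X).
Proof. exact: wge0_isomorphic (shift_unshift X). Qed.

(** Objects of C_(w<=-1) have no nonzero maps to A. If X has no nonzero map from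
    them, then in the weight decomposition of X[1] the map L -> X[1] vanishes and
    X[1] is a retract of R. *)
Lemma wge0_biperp : rperp (lperp A) `<=` A.
Proof.
move=> X XP; have [L [R [f [g [h [LL [W AW RW] fgh]]]]]] := weight_decomp w (shift X).
have f0 : f = 0.
  have [e [e' [e'e ee']]] := shift_unshift L.
  have [f' f'E] := shift_full (f \c e).
  have f'0 : f' = 0.
    apply: XP => Y AY a; apply: shift_inj0.
    have := weight_orth LL (shift_class1 AY) (fmap shift a \c e').
    move/(congr1 (fun b => b \c e)).
    by rewrite -mcompA e'e mcompm1 mcomp0l.
  by rewrite -[f]mcompm1 -ee' mcompA -f'E f'0 raddf0 mcomp0l.
have [|b bg] := dist_weak_cokernel fgh (a := idm (shift X)).
  by rewrite f0 mcomp0.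
have [i [r ri]] := iso_retract RW.
apply: (wge0_retracts _ AW); apply: shift_reflects_retract.
exists (i \c g), (b \c r).
by rewrite -mcompA (mcompA r) ri mcomp1m.
Qed.

(** The weight decomposition L -> X[1] -> W[1] of X[1], shifted back. A map from
    W[1] to Y[2] vanishing on X[1] comes from L[1] -> Y[2], hence from L -> Y[1],
    which is zero by orthogonality. *)
Lemma wge0_reflection X : exists W (r : mor X W),
  weakly_reflects A r /\ epic_into (shift_class A 1) r.
Proof.
have [L [R [f [g [h [LL [W AW [e [e' [e'e ee']]]] fgh]]]]]] :=
  weight_decomp w (shift X).
have [r rE] := shift_full (e \c g); exists W, r; split; first split=> //.
  move=> Y AY a.
  have [b bg] := dist_weak_cokernel fgh
    (weight_orth LL (shift_class1 AY) (fmap shift a \c f)).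
  have [b' b'E] := shift_full (b \c e'); exists b'; apply: shift_faithful.
  by rewrite fmapM b'E rE -mcompA (mcompA e') e'e mcomp1m.
move=> Y [V AV [i [i' [i'i ii']]]] k kr0.
pose k' := i \c k.
suff k'0 : k' = 0 by rewrite -[k]mcomp1m -i'i -mcompA -/k' k'0 mcomp0.
have k'r0 : fmap shift k' \c e \c g = 0.
  by rewrite -mcompA -rE -fmapM /k' -mcompA kr0 mcomp0 raddf0.
have gh : dist g h (- fmap shift f) by rewrite -tr2.
have [b bh] := dist_weak_cokernel gh k'r0.
have [b' b'E] := shift_full b.
have b'0 : b' = 0 := weight_orth LL (shift_class1 AV) b'.
apply: shift_inj0; rewrite -[LHS]mcompm1 -ee' mcompA -bh -b'E b'0 raddf0.
by rewrite !mcomp0l.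
Qed.

(** The reflection of X[1] shifted back once more. *)
Lemma desuspension_reflection X : exists W (r : mor X W),
  weakly_reflects (desuspension A) r /\ epic_into A r.
Proof.
have [W [r [[AW rA] r_epic]]] := wge0_reflection (shift X).
have [e [e' [e'e ee']]] := shift_unshift W.
have [r' r'E] := shift_full (e' \c r).
exists (unshift W), r'; split; first split.
- exact: wge0_unshift.
- move=> Y AY a; have [b br] := rA _ AY (fmap shift a).
  have [b' b'E] := shift_full (b \c e); exists b'; apply: shift_faithful.
  by rewrite fmapM b'E r'E -mcompA (mcompA e) ee' mcomp1m.
move=> Y AY k kr0; apply: shift_inj0.
have : fmap shift k \c e' = 0.
  apply: r_epic (shift_class1 AY) _ _.
  by rewrite -mcompA -r'E -fmapM kr0 raddf0.
move/(congr1 (fun b => b \c e)).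
by rewrite -mcompA e'e mcompm1 mcomp0l.
Qed.

Hypothesis brown : brown_representability C.
Hypothesis A_coprod : closed_under_coproducts A.

Lemma wge0_coreflection M : exists L (e : mor L M),
  [/\ A L, forall X, A X -> forall m : mor X M, exists g, e \c g = m
    & forall X, desuspension A X -> forall g : mor X L, e \c g = 0 -> g = 0].
Proof.
have [R0 /dependent_choice[r0 r0P]] := choice wge0_reflection.
have [R1 /dependent_choice[r1 r1P]] := choice desuspension_reflection.
apply: (@brown_coreflection _ A wge0_biperp wge0_sub_desuspension A_coprod
  brown.1 R0 R1 r0 r1 _ _ _ _ brown.2) => X.
- exact: (r0P X).1.
- exact: (r1P X).1.
- exact: (r1P X).2.
Qed.

(** A map X -> R from an object of A is composed with R -> L[1]; the result dies in
    M[1], hence vanishes by injectivity of C(X[-1],L) -> C(X[-1],M), because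
    X[-1] is in A[-1]. So X -> R lifts to M, hence to L, and is zero. *)
Lemma wge0_t_decomp M :
  exists (L R : C) (f : mor L M) (g : mor M R) (h : mor R (shift L)),
    [/\ A L, rperp A R & dist f g h].
Proof.
have [L [e [AL e_onto e_inj]]] := wge0_coreflection M.
have [R [g [h egh]]] := tr1_cone e; exists L, R, e, g, h; split=> //.
move=> X AX m.
have gh : dist g h (- fmap shift e) by rewrite -tr2.
have he : dist h (- fmap shift e) (- fmap shift g) by rewrite -tr2.
have [i [i' [i'i ii']]] := shift_unshift X.
have [a aE] := shift_full (h \c m \c i).
have a0 : a = 0.
  apply: e_inj; first exact: wge0_unshift AX.
  apply: shift_inj0; apply: oppr_inj; rewrite oppr0 fmapM aE -!mcompA -mcompNl.
  by rewrite mcompA (dist_comp0 he) mcomp0l.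
have hm0 : h \c m = 0.
  by rewrite -[h \c m]mcompm1 -ii' mcompA -aE a0 raddf0 mcomp0l.
have [b <-] := dist_weak_kernel gh hm0; have [c <-] := e_onto X AX b.
by rewrite mcompA (dist_comp0 egh) mcomp0l.
Qed.

(** Orthogonality to A[1], not to A: this is C^(t>=0), whereas the decomposition
    involves C^(t>=1), obtained from it by desuspension. *)
Definition adjacent_tge0 : set C := rperp (shift_class A 1).

Lemma adjacent_tge0_shift : adjacent_tge0 `<=` shift_class adjacent_tge0 1.
Proof.
move=> Y YP; exists (unshift Y); last exact/isomorphic_sym/shift_unshift.
move=> P [W AW PW] f; have [e [e' [e'e ee']]] := shift_unshift Y.
apply: shift_inj0; have AP : A P by apply: wge0_shift; exists W.
have := YP _ (shift_class1 AP) (e \c fmap shift f).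
move/(congr1 (mcomp e')).
by rewrite mcompA e'e mcomp1m mcomp0.
Qed.

Lemma adjacent_t_decomp M :
  exists (L R : C) (f : mor L M) (g : mor M R) (h : mor R (shift L)),
    [/\ A L, shift_class adjacent_tge0 (-1) R & dist f g h].
Proof.
have [L [R [f [g [h [AL RP fgh]]]]]] := wge0_t_decomp M.
exists L, R, f, g, h; split=> //; exists (shift R).
  move=> P [W AW [i [i' [i'i ii']]]] a.
  have [b bE] := shift_full (a \c i').
  by rewrite -[a]mcompm1 -i'i mcompA -bE (RP W AW b) raddf0 mcomp0l.
exact/isomorphic_sym/unshift_shift.
Qed.

Definition adjacent_t_structure : t_structure C.
Proof.
apply: (@TStructure C A adjacent_tge0).
- exact: wge0_isomorphic.
- by move=> X Y /iso_retract; apply: rperp_retract.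
- exact: wge0_shift.
- exact: adjacent_tge0_shift.
- by move=> X Y AX YP; apply: YP.
- exact: adjacent_t_decomp.
Defined.

End WeightStructure.

(** C_(w>=1) is perpendicular to compact objects, hence closed under coproducts,
    and the shift, being an equivalence, carries coproducts in C_(w>=0) to it. *)
Lemma generated_wge0_coproducts (C : triangulated) (w : weight_structure C)
    (P : set C) :
  P `<=` @compact C -> weight_generated_by w P ->
  closed_under_coproducts (wge0 w).
Proof.
move=> Pcpt wP I X S inj copS AX.
have [W AW SW] : wge w 1 (shift S).
  rewrite wP; apply: (compact_rperp_coproducts Pcpt (shift_coproduct copS)).
  by move=> i; rewrite -wP; apply: shift_class1.
by apply: wge0_retracts AW; apply/shift_reflects_retract/iso_retract.
Qed.

Theorem proposition3p3p6 (C : triangulated) (P P' : set C)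
    (s s' : torsion_pair C) (Ps Ps' : set C)
    (hs : generates Ps s) (hs' : cogenerates Ps' s') :
  (* 1 *)
  (weakly_symmetric Ps P' <-> weakly_symmetric (LO s) P') /\
  (* 2 *)
  (weakly_symmetric P Ps' <-> weakly_symmetric P (RO s')) /\
  (* 3 *)
  [/\ weakly_symmetric Ps Ps' <-> symmetric_to (LO s) (RO s'),
      weakly_symmetric Ps Ps' <->
        (exists Q Q' : set C,
           [/\ generates Q s, cogenerates Q' s' & symmetric_to Q Q'])
    & weakly_symmetric Ps Ps' <-> left_adjacent s s'] /\
  (* 4 *)
  (brown_representability C -> Ps `<=` @compact C -> left_adjacent s s' ->
     [/\ smashing s, cosmashing s', have_bc_duals Ps
       & cogenerates (bc_duals Ps) s']) /\
  (* 5 *)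
  (brown_representability C -> P `<=` @compact C ->
     forall w : weight_structure C, weight_generated_by w P ->
     [/\ weight_smashing w, have_bc_duals P
       & exists t : t_structure C,
           [/\ t_cosmashing t, t_right_adjacent t w
             & t_cogenerated_by t (bc_duals P)]]).
Proof.
have adjE : weakly_symmetric Ps Ps' <-> left_adjacent s s'.
  by rewrite /weakly_symmetric /left_adjacent hs hs'.
have genLO : generates (LO s) s by rewrite /generates torsion_rperp.
have cogenRO : cogenerates (RO s') s' by rewrite /cogenerates -torsion_lperp.
split; first by rewrite /weakly_symmetric -hs genLO.
split; first by rewrite /weakly_symmetric -hs' cogenRO.
have ws_of_sym Q Q' : generates Q s -> cogenerates Q' s' ->
    symmetric_to Q Q' -> weakly_symmetric Ps Ps'.
  move=> hQ hQ' /symmetric_weakly_symmetric.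
  by rewrite /weakly_symmetric -hs -hs' hQ hQ'.
split.
  split=> //; split.
  - by move=> /adjE; apply: left_adjacent_symmetric.
  - exact: ws_of_sym.
  - move=> /adjE/left_adjacent_symmetric sym.
    by exists (LO s), (RO s').
  - by case=> Q [Q' []]; apply: ws_of_sym.
split=> [brown Pcpt adj|brown Pcpt w wP].
  have duals := compact_have_bc_duals brown Pcpt.
  split=> //.
  - by split; [exact: brown.1 | rewrite hs; apply: compact_rperp_coproducts].
  - split; first exact: brown_has_products.
    by rewrite -adj hs; apply: rperp_products.
  - by rewrite /cogenerates -adj hs; apply: rperp_lperp_bc_duals.
have duals := compact_have_bc_duals brown Pcpt.
have w_coprod := generated_wge0_coproducts Pcpt wP.
split=> //; first by split; first exact: brown.1.
exists (adjacent_t_structure brown w_coprod); split=> //.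
- split; first exact: brown_has_products.
  move=> I X S proj prodS AX; apply: wge0_biperp.
  by apply: rperp_products prodS _ => i; apply/sub_rperp_lperp/AX.
- by rewrite /t_cogenerated_by -rperp_lperp_bc_duals // -wP.
Qed.
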